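(* In the setting described in the context (feature regularity, the assumption on the inverse link function $f$, the constant $L\ge 1$, and $\gamma<1/L^2$), choose $\alpha=\frac{1-\gamma L^2}{4L^3}>0$. Then the projected expected update $w\mapsto \mathcal{P}(w+\alpha\,\overline g(w))$ on $\mathcal{W}$ is a contraction with respect to $\|\cdot\|_2$ with a unique fixed point $w^*\in\mathcal{W}$, and the iterates $w_{t+1}=\mathcal{P}(w_t+\alpha\,\overline g(w_t))$, $w_0\in\mathcal{W}$, converge to $w^*$.
   Context: Setting. $\mathcal{S}$ is a finite state space (the training points), with a Markov transition kernel $P(s'\mid s)$, a stationary distribution $D(s)$ of $P$, a discount factor $\gamma\in(0,1)$, and a feature map $x:\mathcal{S}\to\mathbb{R}^d$. Each state $s$ has a label $\ell(s)\in\mathcal{Y}\subseteq\mathbb{R}$. $f:\mathbb{R}\to\mathcal{Y}$ is the inverse link function and the reward of a transition $s\to s'$ is $r=r(s,s')=f^{-1}(\ell(s))-\gamma f^{-1}(\ell(s'))$. $\mathcal{W}\subset\mathbb{R}^d$ is a nonempty convex compact set and $\mathcal{P}(w)=\arg\min_{u\in\mathcal{W}}\|w-u\|_2^2$ is the projection onto it. Assumptions. (1) Feature regularity: $\|x(s)\|_2\le 1$ for all $s\in\mathcal{S}$, and $\Sigma=\sum_s D(s)x(s)x(s)^\top$ has full rank. (2) $f$ is continuous, invertible, strictly increasing and has a derivative $f'$ that is bounded on any bounded domain. (3) $L\ge 1$ is a constant such that, for $w\in\mathcal{W}$ and all $s_1,s_2\in\mathcal{S}$, with $z_1=x(s_1)^\top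 w$ and $z_2=x(s_2)^\top w$, one has $\frac1L|z_1-z_2|\le|f(z_1)-f(z_2)|\le L|z_1-z_2|$. (4) Bounded discount: $\gamma<1/L^2$ for this $L$. Expected update. $\overline g(w)=\mathbb{E}\big[(f(r(s,s')+\gamma x(s')^\top w)-f(x(s)^\top w))\,x(s)\big]$, with $s\sim D$, $s'\sim P(\cdot\mid s)$.
   Formalization: Assumption (3) as printed (one w, predictions only) makes the claim false; here its two-sided bound is required for predictions at any two parameters in W, and the upper bound L also at the target arguments r+γx(s')ᵀw of each possible transition. *)

(* Defs.v *)
From HB Require Import structures.
From mathcomp Require Import all_boot all_order all_algebra.
From mathcomp Require Import all_classical all_reals all_analysis.

Set Implicit Arguments.
Unset Strict Implicit.
Unset Printing Implicit Defensive.

Import Order.TTheory GRing.Theory Num.Theory.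
Import numFieldNormedType.Exports.

Local Open Scope classical_set_scope.
Local Open Scope ring_scope.

Section Euclidean.
Context {R : realType} {d : nat}.
Implicit Types (u v w : 'cV[R]_d) (W : set 'cV[R]_d).

Definition dot u v : R := (u^T *m v) 0 0.

(* The library norm on matrices is the max norm, hence this definition.  Both
   norms induce the same topology, so compactness below is the usual one. *)
Definition norm2 u : R := Num.sqrt (\sum_i u i 0 ^+ 2).

Definition argmin W (F : 'cV[R]_d -> R) : set 'cV[R]_d :=
  [set u | W u /\ forall v, W v -> F u <= F v].

(* The default value 0 is irrelevant when W is nonempty, convex and compact:
   the argmin is then a singleton. *)
Definition proj W w : 'cV[R]_d :=
  xget 0 (argmin W (fun u => norm2 (w - u) ^+ 2)).

Definition contraction_on W (T : 'cV[R]_d -> 'cV[R]_d) : Prop :=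
  (forall w, W w -> W (T w)) /\
  exists2 k : R, 0 <= k < 1 &
    forall w1 w2, W w1 -> W w2 -> norm2 (T w1 - T w2) <= k * norm2 (w1 - w2).

End Euclidean.

Section MarkovChain.
Context {R : realType} {S : finType}.

Definition distribution (D : S -> R) : Prop :=
  (forall s, 0 <= D s) /\ \sum_s D s = 1.

(* P s s' is the probability P(s' | s) of the transition from s to s'. *)
Definition transition_kernel (P : S -> S -> R) : Prop :=
  forall s, distribution (P s).

Definition stationary (P : S -> S -> R) (D : S -> R) : Prop :=
  distribution D /\ forall s', \sum_s D s * P s s' = D s'.

End MarkovChain.

Section GeneralizedTD.
Context {R : realType} {S : finType} {d : nat}.
Variables (P : S -> S -> R) (D : S -> R) (gamma : R) (x : S -> 'cV[R]_d)
  (l : S -> R) (f : R -> R).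

Definition second_moment : 'M[R]_d := \sum_s D s *: (x s *m (x s)^T).

(* Inverse of f, seen as a bijection from R onto its range. *)
Definition link : R -> R := 'pinv_(fun=> 0) [set: R] f.

Definition reward (s s' : S) : R := link (l s) - gamma * link (l s').

(* The bootstrapped target is f applied to this quantity. *)
Definition target_arg (w : 'cV[R]_d) (s s' : S) : R :=
  reward s s' + gamma * dot (x s') w.

Definition expected_update (w : 'cV[R]_d) : 'cV[R]_d :=
  \sum_s \sum_s' (D s * P s s') *:
    ((f (target_arg w s s') - f (dot (x s) w)) *: x s).

Definition projected_update (W : set 'cV[R]_d) (alpha : R) (w : 'cV[R]_d) :
    'cV[R]_d :=
  proj W (w + alpha *: expected_update w).

(* L is a bi-Lipschitz constant of f on the predictions x(s)^T w and a
   Lipschitz constant of f on the target arguments, for parameters in W.  The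
   two points compared may come from two different parameters: if both come
   from the same one, the increments of expected_update are not controlled
   (with a single state such a condition is even void). *)
Definition link_constant (W : set 'cV[R]_d) (L : R) : Prop :=
  (forall w1 w2 s1 s2, W w1 -> W w2 ->
    let z1 := dot (x s1) w1 in
    let z2 := dot (x s2) w2 in
    L^-1 * `|z1 - z2| <= `|f z1 - f z2| <= L * `|z1 - z2|) /\
  (forall w1 w2 s s', W w1 -> W w2 -> 0 < D s * P s s' ->
    let z1 := target_arg w1 s s' in
    let z2 := target_arg w2 s s' in
    `|f z1 - f z2| <= L * `|z1 - z2|).

End GeneralizedTD.

(* Main.v *)
Require Import Defs.
From HB Require Import structures.
From mathcomp Require Import all_boot all_order all_algebra.
From mathcomp Require Import ring lra.
From mathcomp Require Import all_classical all_reals all_analysis.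

Set Implicit Arguments.
Unset Strict Implicit.
Unset Printing Implicit Defensive.

Import Order.TTheory GRing.Theory Num.Theory.
Import numFieldNormedType.Exports.

Local Open Scope classical_set_scope.
Local Open Scope ring_scope.

(** Write u = w1 - w2, a(s) = x(s)^T u, E = E[a(s)^2], and let Delta be the
    increment of the expected update between w2 and w1.  The TD error changes
    by at most gamma L |a(s')| through the target and by L^-1 to L times a(s),
    with the sign of a(s) since f is increasing, through the prediction.  As s
    and s' are both distributed according to D, AM-GM and Jensen give
      <u, Delta> <= (gamma L - 1/L) E    and    |Delta|^2 <= 4 L^2 E.
    For the chosen alpha, gamma L - 1/L = - 4 L^2 alpha, hence
      |u + alpha Delta|^2 <= |u|^2 - 4 L^2 alpha^2 E,
    and E >= |u|^2 / C because Sigma is invertible.  The projection is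
    nonexpansive, and on a compact set the fixed point of a contraction T is
    obtained as a minimizer of |T w - w|. *)

(** * Inner product and Euclidean norm *)

Section EuclideanTheory.
Context {R : realType} {d : nat}.
Implicit Types (u v w : 'cV[R]_d) (W : set 'cV[R]_d).

Lemma dotE u v : dot u v = \sum_i u i 0 * v i 0.
Proof. by rewrite /dot mxE; apply: eq_bigr => i _; rewrite mxE. Qed.

Lemma dotC u v : dot u v = dot v u.
Proof. by rewrite !dotE; apply: eq_bigr => i _; rewrite mulrC. Qed.

Lemma dotDl u v w : dot (u + v) w = dot u w + dot v w.
Proof. by rewrite /dot linearD mulmxDl mxE. Qed.

Lemma dotZl a u v : dot (a *: u) v = a * dot u v.
Proof. by rewrite /dot linearZ -scalemxAl mxE. Qed.

Lemma dotDr u v w : dot u (v + w) = dot u v + dot u w.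
Proof. by rewrite dotC dotDl !(dotC u). Qed.

Lemma dotZr a u v : dot u (a *: v) = a * dot u v.
Proof. by rewrite dotC dotZl dotC. Qed.

Lemma dotNl u v : dot (- u) v = - dot u v.
Proof. by rewrite -scaleN1r dotZl mulN1r. Qed.

Lemma dotNr u v : dot u (- v) = - dot u v.
Proof. by rewrite dotC dotNl dotC. Qed.

Lemma dot0l v : dot 0 v = 0.
Proof. by rewrite -(scale0r 0) dotZl mul0r. Qed.

Lemma dot_sumr (I : finType) u (F : I -> 'cV[R]_d) :
  dot u (\sum_i F i) = \sum_i dot u (F i).
Proof. by rewrite /dot mulmx_sumr summxE. Qed.

Definition dot_simp := (dotDl, dotDr, dotNl, dotNr, dotZl, dotZr).

Lemma dot_ge0 u : 0 <= dot u u.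
Proof. by rewrite dotE sumr_ge0 // => i _; rewrite -expr2 sqr_ge0. Qed.

Lemma dot_eq0 u : dot u u = 0 -> u = 0.
Proof.
rewrite dotE => /psumr_eq0P u0; apply/colP => i; rewrite mxE.
by apply/eqP; rewrite -sqrf_eq0 expr2 u0 // => j _; rewrite -expr2 sqr_ge0.
Qed.

Lemma norm2E u : norm2 u = Num.sqrt (dot u u).
Proof. by rewrite /norm2 dotE; congr Num.sqrt; apply: eq_bigr. Qed.

Lemma sqr_norm2 u : norm2 u ^+ 2 = dot u u.
Proof. by rewrite norm2E sqr_sqrtr // dot_ge0. Qed.

Lemma norm2_ge0 u : 0 <= norm2 u.
Proof. exact: sqrtr_ge0. Qed.

Lemma norm2_eq0 u : norm2 u = 0 -> u = 0.
Proof. by move=> u0; apply: dot_eq0; rewrite -sqr_norm2 u0 expr0n. Qed.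

Lemma norm2N u : norm2 (- u) = norm2 u.
Proof. by rewrite !norm2E dotNl dotNr opprK. Qed.

Lemma norm2B u v : norm2 (u - v) = norm2 (v - u).
Proof. by rewrite -norm2N opprB. Qed.

(** The squared norm of [dot v v *: u - dot u v *: v] is [dot v v] times the gap between the two
    sides; the case [v = 0] is separate. *)
Lemma Cauchy_Schwarz u v : dot u v ^+ 2 <= dot u u * dot v v.
Proof.
have := dot_ge0 (dot v v *: u - dot u v *: v).
rewrite !dot_simp (dotC v u).
have := dot_ge0 v; rewrite le_eqVlt => /orP[/eqP/esym v0 _|v0].
  by rewrite (dot_eq0 v0) dotC dot0l expr0n dot0l mulr0.
move=> h; rewrite -subr_ge0 -(pmulr_rge0 _ v0); apply: le_trans h _.
by rewrite le_eqVlt; apply/orP; left; apply/eqP; ring.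
Qed.

Lemma ler_norm2D u v : norm2 (u + v) <= norm2 u + norm2 v.
Proof.
have uv_ge0 : 0 <= norm2 u + norm2 v by rewrite addr_ge0 ?norm2_ge0.
rewrite -ler_sqr ?nnegrE ?norm2_ge0 // sqr_norm2 !dot_simp (dotC v u).
rewrite sqrrD !sqr_norm2.
suff : dot u v <= norm2 u * norm2 v by lra.
apply: le_trans (ler_norm _) _.
rewrite -ler_sqr ?nnegrE ?mulr_ge0 ?norm2_ge0 // real_normK ?num_real //.
by rewrite exprMn !sqr_norm2 Cauchy_Schwarz.
Qed.

Lemma norm2_triangle v u w : norm2 (u - w) <= norm2 (u - v) + norm2 (v - w).
Proof. by have := ler_norm2D (u - v) (v - w); rewrite addrA subrK. Qed.

(** Cauchy-Schwarz on each row gives the squared Frobenius norm as a bound. The added 1 ensures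
    [1 <= C], so that [C] can later serve as a divisor. *)
Lemma norm2_mulmx_bound (M : 'M[R]_d) :
  exists2 C : R, 1 <= C & forall v, dot (M *m v) (M *m v) <= C * dot v v.
Proof.
exists (1 + \sum_i dot (row i M)^T (row i M)^T).
  by rewrite lerDl sumr_ge0 // => i _; exact: dot_ge0.
move=> v; rewrite mulrDl mul1r; apply: ler_wpDl; first exact: dot_ge0.
rewrite [leLHS]dotE mulr_suml; apply: ler_sum => i _; rewrite -expr2.
suff -> : (M *m v) i 0 = dot (row i M)^T v by exact: Cauchy_Schwarz.
by rewrite /dot trmxK -row_mul [RHS]mxE.
Qed.

(* The variance of the weighted family is nonnegative. *)
Lemma Jensen_dot (I : finType) (c : I -> R) (v : I -> 'cV[R]_d) :
  (forall i, 0 <= c i) -> \sum_i c i = 1 ->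
  dot (\sum_i c i *: v i) (\sum_i c i *: v i) <= \sum_i c i * dot (v i) (v i).
Proof.
move=> c0 c1; set m := \sum_i c i *: v i; rewrite -subr_ge0.
have -> : \sum_i c i * dot (v i) (v i) - dot m m =
    \sum_i c i * dot (v i - m) (v i - m).
  transitivity (\sum_i (c i * dot (v i) (v i) - 2 * dot m (c i *: v i)
      + c i * dot m m)).
    rewrite big_split sumrB -mulr_sumr -dot_sumr -mulr_suml c1 -/m /=; ring.
  by apply: eq_bigr => i _; rewrite !dot_simp (dotC m); ring.
by apply: sumr_ge0 => i _; rewrite mulr_ge0 ?dot_ge0.
Qed.

(** * Minima on compact sets and the Euclidean projection *)

Lemma cvg_norm2 v : (fun u => norm2 (u - v)) @ v --> 0.
Proof.
(* The topology comes from the max norm, so continuity is obtained through the coordinates, then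
   through the square root. *)
have cont_sum : continuous (fun u : 'cV[R]_d => \sum_i (u - v) i 0 ^+ 2).
  apply: continuous_big => [|i _ u]; first exact: add_continuous.
  rewrite /continuous_at mxE; under eq_fun do rewrite mxE.
  apply: (@continuous_comp _ _ _ (fun u : 'cV[R]_d => u i 0 + (- v) i 0)
    (fun y : R => y ^+ 2)); last exact: exprn_continuous.
  apply: continuousD; last exact: cst_continuous.
  exact: coord_continuous.
have cont_norm2 : continuous (fun u => norm2 (u - v)).
  by move=> u; exact: (continuous_comp (cont_sum u) (@sqrt_continuous R _)).
by have := cont_norm2 v; rewrite /continuous_at subrr norm2E dot0l sqrtr0.
Qed.

(** Being Lipschitz for [norm2] implies continuity on [W], so the extreme value theorem applies. *)
Lemma lipschitz_min_attained (W : set 'cV[R]_d) (F : 'cV[R]_d -> R) (C : R) :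
  W !=set0 -> compact W ->
  (forall u v, W u -> W v -> `|F u - F v| <= C * norm2 (u - v)) ->
  exists2 u, W u & forall v, W v -> F u <= F v.
Proof.
move=> W0 Wc FC.
have [|u /set_mem Wu uF] := @compact_EVT_min _ _ F W W0 Wc; last first.
  by exists u => // v Wv; apply: uF; rewrite inE.
apply/subspace_continuousP => v Wv; apply/cvgrPdist_lt => e e0.
(* [C] may be zero or negative, hence the positive upper bound [|C| + 1] as divisor. *)
have C0 : 0 < `|C| + 1 by rewrite ltr_wpDl.
have := cvg_norm2 v; move/cvgrPdist_lt => /(_ (e / (`|C| + 1))).
rewrite divr_gt0 // => /(_ isT) h.
apply: filterS h => u /=; rewrite sub0r normrN ger0_norm ?norm2_ge0 // => h Wu.
rewrite ltr_pdivlMr // in h; apply: le_lt_trans h.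
rewrite distrC; apply: le_trans (FC _ _ Wu Wv) _.
rewrite mulrC ler_wpM2l ?norm2_ge0 //; have := ler_norm C; lra.
Qed.

(* Unqualified, proj is the coordinate projection of product topologies. *)
Lemma proj_argmin W w : W !=set0 -> compact W ->
  argmin W (fun u => norm2 (w - u)) (Defs.proj W w).
Proof.
move=> W0 Wc.
have [u v _ _|u Wu umin] := @lipschitz_min_attained W (fun u => norm2 (w - u)) 1 W0 Wc.
  have h1 := norm2_triangle v w u; have h2 := norm2_triangle u w v.
  rewrite (norm2B v u) in h1.
  by rewrite mul1r ler_norml; apply/andP; split; lra.
have [Wp pmin] : argmin W (fun u => norm2 (w - u) ^+ 2) (Defs.proj W w).
  (* Once a minimizer is exhibited, [xget] returns an element of the argmin and not its default
     value. *)
  apply: xgetPex; exists u; split=> // v Wv.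
  by rewrite ler_sqr ?nnegrE ?norm2_ge0 // umin.
by split=> // v Wv; rewrite -ler_sqr ?nnegrE ?norm2_ge0 // pmin.
Qed.

(** If the inner product were positive, a step from the projection towards [v], which stays in [W]
    by convexity, would come strictly closer to [w]. *)
Lemma proj_variational W w v : W !=set0 -> convex_set W -> compact W -> W v ->
  dot (w - Defs.proj W w) (v - Defs.proj W w) <= 0.
Proof.
move=> W0 Wconv Wc Wv; have [] := proj_argmin w W0 Wc.
set p := Defs.proj W w => Wp pmin.
rewrite leNgt; apply/negP => a_gt0; have b_ge0 := dot_ge0 (v - p).
move: a_gt0 b_ge0; set a := dot _ _; set b := dot _ _ => a_gt0 b_ge0.
have ab_gt0 : 0 < a + b by rewrite ltr_wpDr.
(* A step [t] changes the squared distance by [- 2 t a + t^2 b]. This choice lies in ]0, 1] even if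
   [b = 0] and satisfies [t b <= a], so the change is at most [- t a < 0]. *)
pose t := a / (a + b).
have t_gt0 : 0 < t by rewrite divr_gt0.
have t_le1 : t <= 1 by rewrite ler_pdivrMr // mul1r lerDl.
have Wt : W (p + t *: (v - p)).
  have -> : p + t *: (v - p) = t *: v + (1 - t) *: p.
    by rewrite scalerBl scale1r scalerBr addrCA.
  by apply/set_mem/(Wconv v p (Itv01 (ltW t_gt0) t_le1)); rewrite inE.
have := pmin _ Wt; rewrite -ler_sqr ?nnegrE ?norm2_ge0 // !sqr_norm2.
have -> : w - (p + t *: (v - p)) = (w - p) - t *: (v - p) by rewrite opprD addrA.
set y := w - p; rewrite !(dotDl y) !(dotDr _ y) !(dotNl, dotNr, dotZl, dotZr).
rewrite (dotC (v - p)) -/a -/b => h.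
have tb : t * b <= a.
  rewrite /t mulrAC ler_pdivrMr // ler_pM2l //; lra.
have : t * a * 2 <= t * (t * b) by lra.
rewrite -mulrA ler_pM2l //; lra.
Qed.

(** With q = p1 - p2 and residuals ri = wi - pi, the hypotheses give <q, r1 - r2> >= 0, so |q + (r1
    - r2)|^2 >= |q|^2. *)
Lemma variational_nonexpansive p1 p2 w1 w2 :
  dot (w1 - p1) (p2 - p1) <= 0 -> dot (w2 - p2) (p1 - p2) <= 0 ->
  norm2 (p1 - p2) <= norm2 (w1 - w2).
Proof.
move=> h1 h2; rewrite -ler_sqr ?nnegrE ?norm2_ge0 // !sqr_norm2.
have -> : w1 - w2 = (p1 - p2) + ((w1 - p1) - (w2 - p2)).
  by rewrite (opprD w2) [X in _ = _ + X]addrACA -opprD [RHS]addrC subrK.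
move: h1 h2; rewrite -(opprB p1 p2) dotNr.
move: (p1 - p2) (w1 - p1) (w2 - p2) => q r1 r2 h1 h2.
have h3 := dot_ge0 (r1 - r2); rewrite dotDl !(dotDr _ q) (dotC (r1 - r2) q).
rewrite (dotDr q r1) dotNr (dotC q r1) (dotC q r2); lra.
Qed.

Lemma proj_nonexpansive W w1 w2 : W !=set0 -> convex_set W -> compact W ->
  norm2 (Defs.proj W w1 - Defs.proj W w2) <= norm2 (w1 - w2).
Proof.
move=> W0 Wconv Wc.
have Wp w : W (Defs.proj W w) by have [] := proj_argmin w W0 Wc.
by apply: variational_nonexpansive; exact: proj_variational.
Qed.

(** * Fixed points of contractions on compact sets *)

Lemma contraction_on_fixpoint W (T : 'cV[R]_d -> 'cV[R]_d) :
  W !=set0 -> compact W -> contraction_on W T ->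
  exists wstar : 'cV[R]_d,
    [/\ W wstar, T wstar = wstar, forall w, W w -> T w = w -> w = wstar
      & forall w0, W w0 -> (fun t => norm2 (iter t T w0 - wstar)) @ \oo --> 0].
Proof.
move=> W0 Wc [WT [k /andP[k0 k1] kT]].
(* The displacement |T u - u| is (1 + k)-Lipschitz by the triangle inequality, and 1 + k <= 2. *)
have [|w Ww wmin] := @lipschitz_min_attained W (fun u => norm2 (T u - u)) 2 W0 Wc.
  move=> u v Wu Wv; have hT := kT _ _ Wu Wv.
  have h1 := norm2_triangle (T v) (T u) u; have h2 := norm2_triangle v (T v) u.
  have h3 := norm2_triangle (T u) (T v) v; have h4 := norm2_triangle u (T u) v.
  rewrite (norm2B v u) in h2; rewrite (norm2B (T v) (T u)) in h3.
  have : k * norm2 (u - v) <= norm2 (u - v) by rewrite ler_piMl ?norm2_ge0 ?ltW.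
  by rewrite ler_norml => *; apply/andP; split; lra.
have eq_of_contracted u v : norm2 (u - v) <= k * norm2 (u - v) -> u = v.
  move=> h; apply/subr0_eq/norm2_eq0/eqP; rewrite eq_le norm2_ge0 andbT.
  rewrite leNgt; apply/negP => uv; move: h; rewrite leNgt => /negP; apply.
  by rewrite gtr_pMl.
have Tw : T w = w.
  (* Minimality at [w], tested at [T w], gives |T w - w| <= |T (T w) - T w| <= k |T w - w|. *)
  apply: eq_of_contracted.
  exact: le_trans (wmin _ (WT _ Ww)) (kT _ _ (WT _ Ww) Ww).
exists w; split=> // [u Wu Tu|w0 Ww0].
  by apply: eq_of_contracted; have := kT _ _ Wu Ww; rewrite Tu Tw.
have iterW t : W (iter t T w0) by elim: t => //= t; exact: WT.
have iter_le t : norm2 (iter t T w0 - w) <= k ^+ t * norm2 (w0 - w).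
  elim: t => [|t IH] /=; first by rewrite mul1r.
  rewrite -{1}Tw exprS -mulrA; apply: le_trans (kT _ _ (iterW t) Ww) _.
  exact: ler_wpM2l.
apply: (@squeeze_cvgr _ _ _ _ (fun=> 0) (fun t => k ^+ t * norm2 (w0 - w))).
- by apply: nearW => t; rewrite norm2_ge0 iter_le.
- exact: cvg_cst.
- rewrite -(mul0r (norm2 (w0 - w))); apply: cvgMr_tmp; apply: cvg_expr.
  by rewrite ger0_norm.
Qed.
End EuclideanTheory.

(** * Feature second moment and the stationary law of transitions *)

Section TDTheory.
Context {R : realType} {S : finType} {d : nat}.
Variables (P : S -> S -> R) (D : S -> R) (x : S -> 'cV[R]_d).
Hypothesis hP : transition_kernel P.
Hypothesis hD : stationary P D.
Hypothesis hx : forall s, norm2 (x s) <= 1.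

(** This is the quadratic form of [second_moment D x] at [u], the quantity E of the outline. *)
Definition mean_sqr_prediction (u : 'cV[R]_d) : R :=
  \sum_s D s * dot (x s) u ^+ 2.

Lemma dot_feature_le1 s : dot (x s) (x s) <= 1.
Proof. by rewrite -sqr_norm2 expr_le1 ?norm2_ge0. Qed.

(** Write u as the inverse of Sigma applied to Sigma u. Since Sigma u is the D-average of a(s) x(s),
    Jensen and |x(s)| <= 1 give |Sigma u|^2 <= E. *)
Lemma mean_sqr_prediction_lower_bound : \rank (second_moment D x) = d ->
  exists2 C : R, 1 <= C & forall u, dot u u <= C * mean_sqr_prediction u.
Proof.
have [[D0 D1] _] := hD.
move=> full; set M := second_moment D x.
have Munit : M \in unitmx by rewrite -row_full_unit /row_full full.
have [C C1 MC] := norm2_mulmx_bound (invmx M).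
exists C => // u.
rewrite -{1 2}(mulKmx Munit u); apply: le_trans (MC _) _.
rewrite ler_wpM2l ?(le_trans ler01) //.
have -> : M *m u = \sum_s D s *: (dot (x s) u *: x s).
  rewrite mulmx_suml; apply: eq_bigr => s _.
  rewrite -scalemxAl -mulmxA; congr (_ *: _).
  by rewrite [_ *m u]mx11_scalar mul_mx_scalar.
apply: le_trans (Jensen_dot _ D0 D1) _; apply: ler_sum => s _.
rewrite ler_wpM2l // dotZl dotZr mulrA -expr2.
by rewrite ler_piMr ?sqr_ge0 ?dot_feature_le1.
Qed.

Let joint (p : S * S) : R := D p.1 * P p.1 p.2.

Lemma joint_ge0 p : 0 <= joint p.
Proof. by have [[D0 _] _] := hD; rewrite mulr_ge0 //; have [] := hP p.1. Qed.

Lemma joint_marginal1 (F : S -> R) :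
  \sum_p joint p * F p.1 = \sum_s D s * F s.
Proof.
rewrite -(pair_bigA _ (fun s s' => D s * P s s' * F s)) /=.
apply: eq_bigr => s _; rewrite -mulr_suml -mulr_sumr.
by have [_ ->] := hP s; rewrite mulr1.
Qed.

(** Summing over the first state first, stationarity makes the next state distributed according to
    [D] as well. *)
Lemma joint_marginal2 (F : S -> R) :
  \sum_p joint p * F p.2 = \sum_s D s * F s.
Proof.
rewrite -(pair_bigA _ (fun s s' => D s * P s s' * F s')) /= exchange_big /=.
apply: eq_bigr => s _; rewrite -mulr_suml.
by have [_ ->] := hD.
Qed.

(** * Increments of the expected update *)

Variables (gamma : R) (l : S -> R) (f : R -> R) (W : set 'cV[R]_d) (L : R).
Hypothesis hgamma : 0 < gamma < 1.
Hypothesis hfmono : {homo f : a b / a < b}.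
Hypothesis hL1 : 1 <= L.
Hypothesis hL : link_constant P D gamma x l f W L.

Let td_error w (p : S * S) :=
  f (target_arg gamma x l f w p.1 p.2) - f (dot (x p.1) w).

Lemma expected_updateE w :
  expected_update P D gamma x l f w = \sum_p joint p *: (td_error w p *: x p.1).
Proof. by rewrite /expected_update pair_bigA; apply: eq_bigr. Qed.

Lemma expected_updateB w1 w2 :
  expected_update P D gamma x l f w1 - expected_update P D gamma x l f w2 =
  \sum_p joint p *: ((td_error w1 p - td_error w2 p) *: x p.1).
Proof.
rewrite !expected_updateE -sumrB; apply: eq_bigr => p _.
by rewrite -scalerBr -scalerBl.
Qed.

(** Split e = t - q into target and prediction increments: |t| <= gamma L |a'|, while q a >= a^2 /
    L. AM-GM handles the cross term t a. The weight of [p] must be positive because [link_constant]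
    controls targets only on such transitions. *)
Lemma td_error_bounds w1 w2 p : W w1 -> W w2 -> 0 < joint p ->
  let e := td_error w1 p - td_error w2 p in
  let a := dot (x p.1) (w1 - w2) in
  let a' := dot (x p.2) (w1 - w2) in
  e * a <= gamma * L * (a ^+ 2 + a' ^+ 2) / 2 - a ^+ 2 / L /\
  e ^+ 2 <= 2 * L ^+ 2 * (a ^+ 2 + a' ^+ 2).
Proof.
move=> Ww1 Ww2 pp /=; have /andP[g0 g1] := hgamma.
have L0 : 0 < L by rewrite (lt_le_trans ltr01).
have [/(_ w1 w2 p.1 p.1 Ww1 Ww2) /= hq /(_ w1 w2 p.1 p.2 Ww1 Ww2 pp) /= ht] := hL.
rewrite /td_error; move: hq ht.
set t1 := target_arg _ _ _ _ w1 _ _; set t2 := target_arg _ _ _ _ w2 _ _.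
set z1 := dot (x p.1) w1; set z2 := dot (x p.1) w2.
have -> : dot (x p.1) (w1 - w2) = z1 - z2 by rewrite dotDr dotNr.
have -> : t1 - t2 = gamma * dot (x p.2) (w1 - w2).
  by rewrite dotDr dotNr /t1 /t2 /target_arg; ring.
set a' := dot (x p.2) _; set t := f t1 - f t2; move=> /andP[hq1 hq2] ht.
have -> : f t1 - f z1 - (f t2 - f z2) = t - (f z1 - f z2) by rewrite /t; ring.
(* Monotonicity of [f] gives q and a the same sign, which turns the lower bound on |q| into one on q
   a. *)
have qa_ge0 : 0 <= (f z1 - f z2) * (z1 - z2).
  have [z12|z12|->] := ltgtP z1 z2; last by rewrite subrr mul0r.
    by rewrite -mulrNN mulr_ge0 // oppr_ge0 subr_le0 ltW // hfmono.
  by rewrite mulr_ge0 // subr_ge0 ltW // hfmono.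
set a := z1 - z2 in hq1 hq2 qa_ge0 *.
set q := f z1 - f z2 in hq1 hq2 qa_ge0 *.
have qa : a ^+ 2 / L <= q * a.
  rewrite -(ger0_norm qa_ge0) normrM -(real_normK (num_real a)).
  by rewrite expr2 mulrC mulrA ler_wpM2r.
have t_le : `|t| <= L * gamma * `|a'|.
  by apply: le_trans ht _; rewrite normrM (gtr0_norm g0) mulrA.
have Lg0 : 0 < L * gamma by rewrite mulr_gt0.
have aa' : `|a'| * `|a| <= (a ^+ 2 + a' ^+ 2) / 2.
  have := sqr_ge0 (`|a'| - `|a|); rewrite sqrrB !real_normK ?num_real //; lra.
split.
  have ta : t * a <= L * gamma * ((a ^+ 2 + a' ^+ 2) / 2).
    apply: le_trans (ler_norm _) _; rewrite normrM.
    apply: le_trans (ler_wpM2r (normr_ge0 _) t_le) _.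
    by rewrite -[leLHS]mulrA ler_pM2l.
  have -> : gamma * L * (a ^+ 2 + a' ^+ 2) / 2 =
      L * gamma * ((a ^+ 2 + a' ^+ 2) / 2).
    by ring.
  by rewrite mulrBl lerB.
(* The factor gamma < 1 is dropped so that t and q share the Lipschitz factor [L]. *)
have t_le' : `|t| <= L * `|a'|.
  apply: le_trans t_le _; rewrite -mulrA ler_pM2l // ler_piMl // ltW //.
have : `|t - q| <= L * (`|a'| + `|a|).
  by apply: le_trans (ler_normB _ _) _; rewrite mulrDr lerD.
rewrite -ler_sqr ?nnegrE ?mulr_ge0 ?addr_ge0 ?(ltW L0) // real_normK ?num_real //.
move=> h; apply: le_trans h _; rewrite exprMn.
have -> : 2 * L ^+ 2 * (a ^+ 2 + a' ^+ 2) = L ^+ 2 * (2 * (a ^+ 2 + a' ^+ 2)).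
  by ring.
rewrite ler_pM2l ?exprn_gt0 // sqrrD !real_normK ?num_real //.
lra.
Qed.

(** The pointwise bounds are averaged over transitions: both marginals are [D], so a^2 and a'^2 each
    contribute E. Jensen and |x(s)| <= 1 bring the squared norm inside the average. *)
Lemma expected_update_bounds w1 w2 : W w1 -> W w2 ->
  let g := expected_update P D gamma x l f w1
    - expected_update P D gamma x l f w2 in
  let E := mean_sqr_prediction (w1 - w2) in
  dot (w1 - w2) g <= (gamma * L - L^-1) * E /\ dot g g <= 4 * L ^+ 2 * E.
Proof.
move=> Ww1 Ww2 /=; rewrite expected_updateB; set E := mean_sqr_prediction _.
pose a s := dot (x s) (w1 - w2) ^+ 2.
have E1 : \sum_p joint p * a p.1 = E by rewrite joint_marginal1.
have E2 : \sum_p joint p * a p.2 = E by rewrite joint_marginal2.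
have joint1 : \sum_p joint p = 1.
  transitivity (\sum_p joint p * 1).
    by apply: eq_bigr => p _; rewrite mulr1.
  rewrite (joint_marginal1 (fun=> 1)) -[RHS](proj2 (proj1 hD)).
  by apply: eq_bigr => s _; rewrite mulr1.
split.
  apply: (@le_trans _ _ (\sum_p ((gamma * L / 2 - L^-1) * (joint p * a p.1)
      + gamma * L / 2 * (joint p * a p.2)))); last first.
    by rewrite big_split -!mulr_sumr /= E1 E2; lra.
  rewrite dot_sumr; apply: ler_sum => p _; rewrite !dotZr (dotC _ (x p.1)).
  (* Transitions of weight zero contribute nothing; the pointwise bound is available on the
     others. *)
  have := joint_ge0 p; rewrite le_eqVlt => /orP[/eqP<-|pp].
    by rewrite !(mul0r, mulr0) addr0.
  have [h _] := td_error_bounds Ww1 Ww2 pp.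
  apply: le_trans (ler_wpM2l (ltW pp) h) _.
  by rewrite /a le_eqVlt; apply/orP; left; apply/eqP; ring.
apply: le_trans (Jensen_dot _ joint_ge0 joint1) _.
apply: (@le_trans _ _ (\sum_p (2 * L ^+ 2 * (joint p * a p.1)
    + 2 * L ^+ 2 * (joint p * a p.2)))); last first.
  by rewrite big_split -!mulr_sumr /= E1 E2; lra.
apply: ler_sum => p _.
rewrite dotZl dotZr (mulrA (td_error w1 p - td_error w2 p)) -expr2.
have := joint_ge0 p; rewrite le_eqVlt => /orP[/eqP<-|pp].
  by rewrite !(mul0r, mulr0) addr0.
have [_ h] := td_error_bounds Ww1 Ww2 pp.
apply: (@le_trans _ _ (joint p * (td_error w1 p - td_error w2 p) ^+ 2)).
  by rewrite ler_wpM2l ?(ltW pp) // ler_piMr ?sqr_ge0 ?dot_feature_le1.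
apply: le_trans (ler_wpM2l (ltW pp) h) _.
by rewrite /a le_eqVlt; apply/orP; left; apply/eqP; ring.
Qed.

(** * Contraction of the projected update *)

Hypothesis W0 : W !=set0.
Hypothesis Wconv : convex_set W.
Hypothesis Wc : compact W.
Hypothesis hSigma : \rank (second_moment D x) = d.
Hypothesis hgammaL : gamma * L ^+ 2 < 1.

Lemma projected_update_contraction :
  contraction_on W
    (projected_update P D gamma x l f W ((1 - gamma * L ^+ 2) / (4 * L ^+ 3))).
Proof.
set alpha := _ / _; have /andP[g0 g1] := hgamma.
have L0 : 0 < L by rewrite (lt_le_trans ltr01).
have Ln0 : L != 0 by rewrite gt_eqF.
split=> [w _|]; first by have [] := proj_argmin
  (w + alpha *: expected_update P D gamma x l f w) W0 Wc.
have [C C1 CE] := mean_sqr_prediction_lower_bound hSigma.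
have C0 : 0 < C by rewrite (lt_le_trans ltr01).
have alpha0 : 0 < alpha by rewrite divr_gt0 ?mulr_gt0 ?exprn_gt0 ?subr_gt0.
have L2_ge1 : 1 <= L ^+ 2 by rewrite exprn_ege1.
have c0 : 0 < 2 * L * alpha by rewrite mulr_gt0 // mulr_gt0.
(* This yields b <= 1 <= C below, hence a nonnegative squared rate 1 - b / C. *)
have c1 : 2 * L * alpha <= 1.
  have -> : 2 * L * alpha = (1 - gamma * L ^+ 2) / (2 * L ^+ 2).
    by rewrite /alpha; field.
  rewrite ler_pdivrMr ?mulr_gt0 ?exprn_gt0 //.
  have : 0 < gamma * L ^+ 2 by rewrite mulr_gt0 ?exprn_gt0.
  lra.
(* The coefficient 4 L^2 alpha^2 of E in the decrease of the squared norm. *)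
pose b := (2 * L * alpha) ^+ 2.
have b0 : 0 < b by exact: exprn_gt0.
have b1 : b <= 1 by apply: exprn_ile1 => //; exact: ltW.
have bC : 0 <= 1 - b / C < 1.
  rewrite subr_ge0 ler_pdivrMr // mul1r (le_trans b1) //=.
  by rewrite ltrBlDr ltrDl divr_gt0.
have /andP[k0 k1] := bC.
exists (Num.sqrt (1 - b / C)).
  by rewrite sqrtr_ge0 -[ltRHS]sqrtr1 ltr_sqrt.
move=> w1 w2 Ww1 Ww2; apply: le_trans (proj_nonexpansive _ _ W0 Wconv Wc) _.
rewrite !norm2E -sqrtrM // ler_wsqrtr //.
have [] := expected_update_bounds Ww1 Ww2.
set g1' := expected_update _ _ _ _ _ _ w1.
set g2' := expected_update _ _ _ _ _ _ w2.
have -> : w1 + alpha *: g1' - (w2 + alpha *: g2') =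
    (w1 - w2) + alpha *: (g1' - g2').
  by rewrite scalerBr opprD addrACA.
have := CE (w1 - w2).
move: (w1 - w2) (g1' - g2') => u g.
move: (mean_sqr_prediction u) => E hE h1 h2.
rewrite dotDl !dotDr !(dotZl, dotZr) (dotC g u).
have {}h1 : alpha * dot u g <= alpha * ((gamma * L - L^-1) * E).
  by rewrite ler_pM2l.
have {}h2 : alpha * (alpha * dot g g) <= alpha * (alpha * (4 * L ^+ 2 * E)).
  by rewrite !ler_pM2l.
(* The decrease b E is converted into a fraction b / C of the squared norm of u. *)
have {}hE : b / C * dot u u <= b * E.
  by rewrite mulrAC ler_pdivrMr // -[leRHS]mulrA ler_pM2l // mulrC.
(* The choice of alpha makes the cross term - 8 L^2 alpha^2 E, twice the size of the quadratic term
   4 L^2 alpha^2 E. *)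
have key : 2 * (alpha * ((gamma * L - L^-1) * E))
    + alpha * (alpha * (4 * L ^+ 2 * E)) = - (b * E).
  have -> : gamma * L - L^-1 = - (4 * L ^+ 2 * alpha) by rewrite /alpha; field.
  by rewrite /b; ring.
move: h1 h2 hE key; lra.
Qed.
End TDTheory.

Theorem theorem5p7 (R : realType) (S : finType) (d : nat)
    (P : S -> S -> R) (D : S -> R) (gamma : R) (x : S -> 'cV[R]_d)
    (Y : set R) (l : S -> R) (f : R -> R) (W : set 'cV[R]_d) (L : R)
    (hP : transition_kernel P)
    (hD : stationary P D)
    (hgamma : 0 < gamma < 1)
    (hl : forall s, Y (l s))
    (hW0 : W !=set0) (hWconv : convex_set W) (hWcomp : compact W)
    (hx : forall s, norm2 (x s) <= 1)
    (hSigma : \rank (second_moment D x) = d)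
    (hfcont : continuous f)
    (hfbij : set_bij [set: R] Y f)
    (hfmono : {homo f : a b / a < b})
    (hfder : forall z, derivable f z 1)
    (hfbnd : forall B : set R, bounded_set B -> bounded_set (f^`()%classic @` B))
    (hL1 : 1 <= L)
    (hL : link_constant P D gamma x l f W L)
    (hgammaL : gamma < 1 / L ^+ 2) :
  let alpha := (1 - gamma * L ^+ 2) / (4 * L ^+ 3) in
  let T := projected_update P D gamma x l f W alpha in
  0 < alpha /\
  contraction_on W T /\
  exists wstar : 'cV[R]_d,
    [/\ W wstar,
        T wstar = wstar,
        forall w, W w -> T w = w -> w = wstar
      & forall w0, W w0 -> (fun t => norm2 (iter t T w0 - wstar)) @ \oo --> 0].
Proof.
move=> alpha T; have L0 : 0 < L by rewrite (lt_le_trans ltr01).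
have gL : gamma * L ^+ 2 < 1 by move: hgammaL; rewrite ltr_pdivlMr ?exprn_gt0.
have T_contraction : contraction_on W T.
  exact: projected_update_contraction.
split; first by rewrite divr_gt0 ?mulr_gt0 ?exprn_gt0 ?subr_gt0.
by split=> //; exact: contraction_on_fixpoint.
Qed.
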